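(* Let $f\ne -z$ be a pseudo-involutory function. Then $$f=\widehat{(\sqrt{zf})}\circ\sqrt{zf}.$$ Moreover, for $h\in\mathcal{F}_1$, one has $f=h\circ\widehat{h}$ if and only if $h=\widehat{(\sqrt{zf})}\circ\phi$ for some odd function $\phi$, i.e. some $\phi\in\mathbb{R}[[z]]$ with $\phi(-z)=-\phi(z)$.
   Context: $\mathcal{F}_k$ denotes the set of formal power series in $\mathbb{R}[[z]]$ of order exactly $k$ (lowest-degree nonzero term in degree $k$). Each $f\in\mathcal{F}_1$ has a compositional inverse $\overline{f}$. The pseudo-inverse of $f\in\mathcal{F}_1$ is $\widehat{f}=(-z)\circ\overline{f}\circ(-z)$, i.e. $\widehat f(z)=-\overline f(-z)$. A function $f\in\mathcal{F}_1$ is pseudo-involutory if $\widehat{f}=f$ (equivalently, $f$ is the second component of some Riordan array $(g,f)$ that is a pseudo-involution; equivalently, $-f$ is a compositional involution). If $f\neq -z$ is pseudo-involutory then $f'(0)=1$, and $\sqrt{zf}=z\sqrt{f/z}\in\mathcal{F}_1$ denotes the square root of $zf$ with leading coefficient $1$. *)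

(* Defs.v *)
From HB Require Import structures.
From mathcomp Require Import all_boot all_order all_algebra.
From mathcomp Require Import ring.
From mathcomp Require Import boolp classical_sets reals.

Set Implicit Arguments.
Unset Strict Implicit.
Unset Printing Implicit Defensive.

Import GRing.Theory.
Local Open Scope ring_scope.

(* Formal power series R[[z]]: [f i] is the coefficient of z^i. *)
Record fps (R : nzRingType) := Fps { fps_coef :> nat -> R }.

Section Ring.
Variable R : comNzRingType.
Implicit Types (f g h : fps R) (n : nat).

HB.instance Definition _ := gen_eqMixin (fps R).
HB.instance Definition _ := gen_choiceMixin (fps R).

Lemma fpsP f g : (forall n, f n = g n) -> f = g.
Proof. by case: f g => [f] [g] /= fg; congr Fps; apply: funext. Qed.

Definition fps_add f g : fps R := Fps (fun n => f n + g n).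
Definition fps_opp f : fps R := Fps (fun n => - f n).
Definition fps_zero : fps R := Fps (fun=> 0).
Definition fps_one : fps R := Fps (fun n => (n == 0%N)%:R).
Definition fps_mul f g : fps R := Fps (fun n => \sum_(i < n.+1) f i * g (n - i)%N).

Definition fps_of_poly (p : {poly R}) : fps R := Fps (fun n => p`_n).
Definition fps_trunc n f : {poly R} := \poly_(i < n) f i.

Lemma fps_truncE n f i : (i < n)%N -> (fps_trunc n f)`_i = f i.
Proof. by move=> lin; rewrite coef_poly lin. Qed.

Fact fps_addA : associative fps_add.
Proof. by move=> f g h; apply: fpsP => n /=; rewrite addrA. Qed.
Fact fps_addC : commutative fps_add.
Proof. by move=> f g; apply: fpsP => n /=; rewrite addrC. Qed.
Fact fps_add0 : left_id fps_zero fps_add.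
Proof. by move=> f; apply: fpsP => n /=; rewrite add0r. Qed.
Fact fps_addN : left_inverse fps_zero fps_opp fps_add.
Proof. by move=> f; apply: fpsP => n /=; rewrite addNr. Qed.

Lemma fps_mul_trunc n f g i : (i < n)%N ->
  fps_mul f g i = (fps_trunc n f * fps_trunc n g)`_i.
Proof.
move=> lin /=; rewrite coefM; apply: eq_bigr => j _.
rewrite !fps_truncE //; first by rewrite (leq_ltn_trans (leq_subr _ _)).
by rewrite (leq_trans (ltn_ord j)).
Qed.

Fact fps_mulC : commutative fps_mul.
Proof.
by move=> f g; apply: fpsP => n; rewrite !(@fps_mul_trunc n.+1) ?ltnS // mulrC.
Qed.

Fact fps_mulA : associative fps_mul.
Proof.
move=> f g h; apply: fpsP => n.
have lt m : (m <= n)%N -> (m < n.+1)%N by [].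
transitivity ((fps_trunc n.+1 f * (fps_trunc n.+1 g * fps_trunc n.+1 h))`_n).
  rewrite coefM /fps_mul /=; apply: eq_bigr => i _.
  by rewrite fps_truncE // -fps_mul_trunc // lt // leq_subr.
rewrite mulrA coefM /fps_mul /=; apply: eq_bigr => i _.
by rewrite fps_truncE ?lt ?leq_subr // -fps_mul_trunc.
Qed.

Fact fps_mul1 : left_id fps_one fps_mul.
Proof.
move=> f; apply: fpsP => n /=; rewrite big_ord_recl /= mul1r subn0 big1 ?addr0 //.
by move=> i _; rewrite mul0r.
Qed.
Fact fps_mulDl : left_distributive fps_mul fps_add.
Proof.
move=> f g h; apply: fpsP => n /=; rewrite -big_split /=.
by apply: eq_bigr => i _; rewrite mulrDl.
Qed.
Fact fps_one_neq0 : fps_one != fps_zero.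
Proof.
by apply/eqP => /(congr1 (fun f : fps R => f 0%N)) /eqP; rewrite /= oner_eq0.
Qed.

HB.instance Definition _ :=
  GRing.isZmodule.Build (fps R) fps_addA fps_addC fps_add0 fps_addN.
HB.instance Definition _ := GRing.Zmodule_isComNzRing.Build (fps R)
  fps_mulA fps_mulC fps_mul1 fps_mulDl fps_one_neq0.

Lemma coef_fpsD f g n : (f + g) n = f n + g n. Proof. by []. Qed.
Lemma coef_fpsN f n : (- f) n = - f n. Proof. by []. Qed.
Lemma coef_fps0 n : (0 : fps R) n = 0. Proof. by []. Qed.
Lemma coef_fps1 n : (1 : fps R) n = (n == 0%N)%:R. Proof. by []. Qed.
Lemma coef_fpsM f g n : (f * g) n = \sum_(i < n.+1) f i * g (n - i)%N.
Proof. by []. Qed.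

Definition fpsX : fps R := Fps (fun n => (n == 1%N)%:R).

(* The sum is the coefficient of z^n in \sum_k f k g^k when g 0 = 0: the terms
   with k > n do not contribute.  Meaningless when g 0 != 0. *)
Definition fps_comp f g : fps R :=
  Fps (fun n => \sum_(k < n.+1) f k * (g ^+ k) n).

(* Order exactly k: the set F_k. *)
Definition fps_order (k : nat) f : Prop :=
  (forall i, (i < k)%N -> f i = 0) /\ f k <> 0.

Definition fps_odd f : Prop := fps_comp f (- fpsX) = - f.

(* The definite descriptions below are meaningful by [fps_compinvP] and
   [fps_sqrtP]; the default value 0 is irrelevant. *)
Definition fps_compinv f : fps R :=
  xget 0 [set g | [/\ fps_order 1 g, fps_comp f g = fpsX & fps_comp g f = fpsX]].

Definition fps_pseudo_inv f : fps R :=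
  fps_comp (- fpsX) (fps_comp (fps_compinv f) (- fpsX)).

Definition fps_pseudo_involutory f : Prop :=
  fps_order 1 f /\ fps_pseudo_inv f = f.

(* The square root of u with leading coefficient 1. *)
Definition fps_sqrt (u : fps R) : fps R :=
  xget 0 [set s | s ^+ 2 = u /\ exists k, fps_order k s /\ s k = 1].

End Ring.

Arguments fpsX {R}.
Notation "f \oF g" := (fps_comp f g) (at level 40, left associativity) : ring_scope.

Section Facts.
Variable R : comNzRingType.
Implicit Types (f g h u : fps R) (p q : {poly R}) (n k : nat).

Definition fps_agree n f g : Prop := forall i, (i < n)%N -> f i = g i.

Let agreeM n f f' g g' : fps_agree n f f' -> fps_agree n g g' -> fps_agree n (f * g) (f' * g').
Proof.
move=> ff gg i lin; rewrite !coef_fpsM; apply: eq_bigr => j _.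
rewrite ff ?gg //; first by rewrite (leq_ltn_trans (leq_subr _ _)).
by rewrite (leq_trans (ltn_ord j)).
Qed.

Lemma fps_agreeX n f f' k : fps_agree n f f' -> fps_agree n (f ^+ k) (f' ^+ k).
Proof. by move=> ff; elim: k => // k IH; rewrite !exprS; apply: agreeM. Qed.

Let agree_comp n f f' g g' :
  fps_agree n f f' -> fps_agree n g g' -> fps_agree n (f \oF g) (f' \oF g').
Proof.
move=> ff gg i lin /=; apply: eq_bigr => k _.
by rewrite ff ?(fps_agreeX _ gg) // (leq_trans (ltn_ord k)).
Qed.

Lemma fps_agreeMS n f f' g g' : f 0%N = 0 -> g 0%N = 0 -> f' 0%N = 0 -> g' 0%N = 0 ->
  fps_agree n f f' -> fps_agree n g g' -> fps_agree n.+1 (f * g) (f' * g').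
Proof.
move=> f0 g0 f0' g0' ff gg i; rewrite ltnS => lin; rewrite !coef_fpsM.
apply: eq_bigr => -[[|j] lji] _ /=; first by rewrite f0 f0' !mul0r.
have [e|ne] := eqVneq j.+1 i; first by rewrite e subnn g0 g0' !mulr0.
have lj : (j.+1 < i)%N by rewrite ltn_neqAle ne.
rewrite ff ?(leq_trans lj) // gg //.
by apply: leq_trans lin; rewrite ltn_subrL /= (leq_trans _ lj).
Qed.

Lemma fps_pow0 g k : g 0%N = 0 -> (0 < k)%N -> (g ^+ k) 0%N = 0.
Proof. by move=> g0; case: k => // k _; rewrite exprS coef_fpsM big_ord1 g0 mul0r. Qed.

Let comp0 f g : (f \oF g) 0%N = f 0%N.
Proof. by rewrite /= big_ord1 expr0 /= mulr1. Qed.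

Lemma fps_coefX_lt g k n : g 0%N = 0 -> (n < k)%N -> (g ^+ k) n = 0.
Proof.
move=> g0; elim: k n => // k IH n; rewrite ltnS => lnk.
rewrite exprS coef_fpsM big1 // => -[[|i] li] _ /=; first by rewrite g0 mul0r.
rewrite IH ?mulr0 // (leq_trans _ lnk) // ltn_subrL /=.
exact: (@leq_ltn_trans i).
Qed.

Lemma fps_compE m f g n : g 0%N = 0 -> (n < m)%N ->
  (f \oF g) n = \sum_(k < m) f k * (g ^+ k) n.
Proof.
move=> g0 lnm /=; rewrite -!(big_mkord xpredT (fun k => f k * (g ^+ k) n)).
rewrite [RHS](@big_cat_nat _ _ _ n.+1) //= [X in _ = _ + X]big_nat_cond.
rewrite [X in _ = _ + X]big1 ?addr0 // => k /andP[/andP[lk _] _].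
by rewrite fps_coefX_lt ?mulr0.
Qed.

Let ofM p q : fps_of_poly (p * q) = fps_of_poly p * fps_of_poly q.
Proof. by apply: fpsP => n /=; rewrite coefM. Qed.

Let ofX p k : fps_of_poly (p ^+ k) = fps_of_poly p ^+ k.
Proof.
elim: k => [|k IH]; last by rewrite !exprS ofM IH.
by apply: fpsP => n /=; rewrite coef1.
Qed.

Let of_comp p q : q`_0 = 0 ->
  fps_of_poly (p \Po q) = fps_of_poly p \oF fps_of_poly q.
Proof.
move=> q0; apply: fpsP => n.
rewrite (@fps_compE (maxn n.+1 (size p))) //; last by rewrite leq_max leqnn.
rewrite /= comp_polyE coef_sum.
rewrite (eq_bigr (fun k : 'I_(size p) => p`_k * (q ^+ k)`_n)); last by move=> k _; rewrite (coefZ p`_k).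
rewrite (big_ord_widen (maxn n.+1 (size p)) (fun k => p`_k * (q ^+ k)`_n));
  last by rewrite leq_max leqnn orbT.
rewrite big_mkcond /=; apply: eq_bigr => k _; rewrite -ofX /=.
by case: ltnP => // /leq_sizeP ->; rewrite ?mul0r.
Qed.

Let agreeT n f : fps_agree n f (fps_of_poly (fps_trunc n f)).
Proof. by move=> i li /=; rewrite fps_truncE. Qed.

Lemma fps_compA f g h : g 0%N = 0 -> h 0%N = 0 ->
  f \oF (g \oF h) = (f \oF g) \oF h.
Proof.
move=> g0 h0; apply: fpsP => n; pose T := @fps_trunc R n.+1.
have T0 u : u 0%N = 0 -> (T u)`_0 = 0 by rewrite fps_truncE.
transitivity ((fps_of_poly (T f \Po (T g \Po T h))) n).
  rewrite of_comp; last first.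
    by have := comp0 (fps_of_poly (T g)) (fps_of_poly (T h)); rewrite -of_comp ?T0 //= => ->; rewrite T0.
  rewrite of_comp ?T0 //; apply: (@agree_comp n.+1) => //.
  by apply: agree_comp; apply: agreeT.
rewrite comp_polyA of_comp ?T0 // of_comp ?T0 //; symmetry.
apply: (@agree_comp n.+1) => //.
by apply: agree_comp; apply: agreeT.
Qed.

Lemma fps_compX f : f \oF fpsX = f.
Proof.
apply: fpsP => n; rewrite /= big_ord_recr /= big1 ?add0r => [|k _].
  suff -> : (fpsX ^+ n : fps R) = fps_of_poly 'X^n.
    by rewrite /= coefXn eqxx mulr1.
  by rewrite ofX; congr (_ ^+ _); apply: fpsP => i /=; rewrite coefX.
suff -> : (fpsX ^+ k : fps R) = fps_of_poly 'X^k.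
  by rewrite /= coefXn (gtn_eqF (ltn_ord k)) mulr0.
by rewrite ofX; congr (_ ^+ _); apply: fpsP => i /=; rewrite coefX.
Qed.

Lemma fps_Xcomp g : g 0%N = 0 -> fpsX \oF g = g.
Proof.
move=> g0; apply: fpsP => -[|n]; first by rewrite comp0 g0.
rewrite /= 2!big_ord_recl /= mul0r add0r mul1r big1 ?addr0 // => i _.
by rewrite mul0r.
Qed.

Lemma fps_compDl f h g : (f + h) \oF g = f \oF g + h \oF g.
Proof.
apply: fpsP => n; rewrite coef_fpsD /= -big_split /=.
by apply: eq_bigr => k _; rewrite mulrDl.
Qed.

Lemma fps_compNl f g : (- f) \oF g = - (f \oF g).
Proof.
by apply: fpsP => n; rewrite coef_fpsN /= -sumrN; apply: eq_bigr => k _; rewrite mulNr.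
Qed.

Lemma fps_fixpoint (F : fps R -> fps R) :
  (forall g, g 0%N = 0 -> F g 0%N = 0) ->
  (forall n g g', g 0%N = 0 -> g' 0%N = 0 -> fps_agree n g g' ->
     fps_agree n.+1 (F g) (F g')) ->
  exists2 g : fps R, g 0%N = 0 & F g = g.
Proof.
move=> F0 Fc; pose G n := iter n F 0.
have G0 n : G n 0%N = 0 by elim: n => //= n IH; apply: F0.
have GS n : fps_agree n (G n) (G n.+1).
  by elim: n => [i //|n IH]; apply: Fc (G0 n) (G0 n.+1) IH.
have GD n m : fps_agree n (G n) (G (n + m)%N).
  elim: m => [|m IH] i li; first by rewrite addn0.
  by rewrite IH // addnS GS // (leq_trans li) ?leq_addr.
pose g := Fps (fun n => G n.+1 n).
have gG n : fps_agree n g (G n).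
  by move=> i li /=; rewrite (GD i.+1 (n - i.+1)%N) // subnKC.
exists g; [exact: (G0 1%N) | apply: fpsP => n].
by rewrite (Fc n g (G n)) ?ltnSn ?G0 //; exact: (G0 1%N).
Qed.

End Facts.

Section Existence.
Variable K : fieldType.
Implicit Types (f g s : fps K).

Lemma fps_orderE f : fps_order 1 f <-> f 0%N = 0 /\ f 1%N <> 0.
Proof.
by split=> [[f0 f1]|[f0 f1]]; split=> //; [apply: f0 | case].
Qed.

Lemma fps_right_inv f : fps_order 1 f ->
  exists2 g : fps K, fps_order 1 g & f \oF g = fpsX.
Proof.
move=> /fps_orderE[f0 /eqP f1].
pose u : fps K := Fps (fun n => if n == 1%N then 0 else f n).
pose v : fps K := Fps (fun n => if n == 1%N then f n else 0).
pose F (g : fps K) : fps K :=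
  Fps (fun n => (f 1%N)^-1 * ((n == 1%N)%:R - (u \oF g) n)).
have fuv : f = u + v.
  by apply: fpsP => n /=; case: eqP; rewrite ?addr0 ?add0r.
have vg g n : g 0%N = 0 -> (v \oF g) n = f 1%N * g n.
  move=> g0; rewrite (@fps_compE _ n.+2) // !big_ord_recl /= mul0r add0r.
  by rewrite big1 ?addr0 ?expr1 // => i _; rewrite mul0r.
have [||g g0 Fg] := @fps_fixpoint _ F.
- by move=> g g0; rewrite /= big_ord1 /= f0 mul0r subrr mulr0.
- move=> n g g' g0 g0' gg i li; congr (_ * (_ - _)).
  rewrite !(@fps_compE _ i.+1) //; apply: eq_bigr => -[[|[|k]] lk] _ /=.
  + by rewrite f0 !mul0r.
  + by rewrite !mul0r.
  congr (_ * _); rewrite -!coef_fpsM.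
  apply: (@fps_agreeMS _ n) li => //; rewrite ?fps_pow0 //; exact: fps_agreeX.
have fg : f \oF g = fpsX.
  apply: fpsP => n; rewrite fuv fps_compDl coef_fpsD vg //.
  have -> : f 1%N * g n = f 1%N * F g n by rewrite Fg.
  by rewrite [F g n]/= mulVKf // addrC subrK.
exists g => //; apply/fps_orderE; split=> // g1.
have := congr1 (fun h : fps K => h 1%N) fg.
rewrite /= !big_ord_recl big_ord0 /= f0 expr1 g1 mul0r mulr0 !add0r => /esym/eqP.
by rewrite oner_eq0.
Qed.

Lemma fps_compinvP f : fps_order 1 f ->
  [/\ fps_order 1 (fps_compinv f), f \oF fps_compinv f = fpsX
     & fps_compinv f \oF f = fpsX].
Proof.
move=> f1; rewrite /fps_compinv; set P : set (fps K) := (X in xget 0 X).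
suff : P (xget 0 P) by []; apply: xgetPex.
have [g g1 fg] := fps_right_inv f1; have [h h1 gh] := fps_right_inv g1.
have [f0 _] := iffLR (fps_orderE f) f1.
have [g0 _] := iffLR (fps_orderE g) g1.
have [h0 _] := iffLR (fps_orderE h) h1.
have hf : h = f by rewrite -(fps_Xcomp h0) -fg -fps_compA // gh fps_compX.
by exists g; split=> //; rewrite -hf.
Qed.

Lemma fps_compinv_unique f g : fps_order 1 f -> g 0%N = 0 ->
  f \oF g = fpsX -> g = fps_compinv f.
Proof.
move=> f1 g0 fg; have [/fps_orderE[i0 _] _ inf] := fps_compinvP f1.
have [f0 _] := iffLR (fps_orderE f) f1.
by rewrite -(fps_Xcomp g0) -inf -fps_compA // fg fps_compX.
Qed.

Lemma fps_sqrtP f : 2%:R != 0 :> K -> f 0%N = 0 -> f 1%N = 1 ->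
  let s := fps_sqrt (fpsX * f) in [/\ s ^+ 2 = fpsX * f, s 0%N = 0 & s 1%N = 1].
Proof.
move=> two0 f0 f1 s.
have XE g n : (fpsX * g) n = if n is m.+1 then g m else 0.
  rewrite coef_fpsM; case: n => [|n]; first by rewrite big_ord1 mul0r.
  rewrite 2!big_ord_recl /= mul0r add0r mul1r subSS subn0 big1 ?addr0 //.
  by move=> i _; rewrite mul0r.
have coefMn g h : g = h -> forall n, g n = h n by move=> ->.
have lead (a : fps K) : a ^+ 2 = fpsX * f -> (exists k, fps_order k a /\ a k = 1) ->
    [/\ a ^+ 2 = fpsX * f, a 0%N = 0 & a 1%N = 1].
  move=> a2 [k [[ak _] a1]].
  have a0 : a 0%N = 0.
    have /eqP := coefMn _ _ a2 0%N.
    by rewrite XE expr2 coef_fpsM big_ord1 mulf_eq0 orbb => /eqP.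
  split=> //; case: k ak a1 => [|[|k]] ak a1 //.
    by move/eqP: a1; rewrite a0 eq_sym oner_eq0.
  have /eqP := coefMn _ _ a2 2%N; rewrite XE f1 expr2 coef_fpsM !big_ord_recl.
  by rewrite big_ord0 /= a0 (ak 1%N) // !mul0r mulr0 !add0r eq_sym oner_eq0.
have [||t t0 Ft] := @fps_fixpoint _ (fun t : fps K =>
    Fps (fun n => 2%:R^-1 * (f n.+1 - (n == 0%N)%:R - (t * t) n))).
- by move=> t t0; rewrite /= big_ord1 t0 mul0r f1 subrr subr0 mulr0.
- move=> n g g' g0 g0' gg i li; congr (_ * (_ - _)).
  exact: (@fps_agreeMS _ n) li.
have ttE : (1 + t) ^+ 2 = Fps (fun n => f n.+1).
  have -> : (1 + t) ^+ 2 = 1 + (t + t) + t * t by ring.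
  apply: fpsP => n; rewrite !coef_fpsD.
  have -> : t n + t n = f n.+1 - (n == 0%N)%:R - (t * t) n.
    have tn : 2%:R^-1 * (f n.+1 - (n == 0%N)%:R - (t * t) n) = t n.
      by rewrite -[in RHS]Ft.
    by rewrite -{1 2}tn; move: (_ - _ - _) => c; field.
  by rewrite -addrA subrK coef_fps1 addrC subrK.
pose r : fps K := fpsX * (1 + t).
have r2 : r ^+ 2 = fpsX * f.
  rewrite exprMn ttE expr2 -mulrA; congr (_ * _); apply: fpsP => -[|n].
    by rewrite XE f0.
  by rewrite XE.
suff [] : s ^+ 2 = fpsX * f /\ exists k, fps_order k s /\ s k = 1 by exact: lead.
apply: (@xgetPex _ 0 [set a | a ^+ 2 = fpsX * f /\ exists k, fps_order k a /\ a k = 1]).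
have r1 : r 1%N = 1 by rewrite XE coef_fpsD t0 addr0.
exists r; split=> //; exists 1%N; split=> //; apply/fps_orderE; rewrite XE r1.
by split=> //; apply/eqP; rewrite oner_eq0.
Qed.

End Existence.

(* Main.v *)
Require Import Defs.
From mathcomp Require Import all_boot all_order all_algebra reals.
Local Open Scope ring_scope.

(** Write N = -z and a^ for the pseudo-inverse of a, which is characterized by
    a o N o a^ = N = a^ o N o a.  Let s = sqrt(z f).  Since f o N o f = N, the
    square z f of s is invariant under substitution of N o f = -f, so s o N o f
    is s or -s; as f'(0) = 1 it is -s = N o s, and composing with s^ o N gives
    f = s^ o s.  Moreover f = h o h^ means f o N o h = h o N, and for
    h = s^ o phi this says that phi commutes with N. *)

Set Implicit Arguments.
Unset Strict Implicit.
Unset Printing Implicit Defensive.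

Import GRing.Theory Num.Theory.

(** * Substitution in power series *)

Section Composition.
Variable R : comNzRingType.
Implicit Types (f g h s t phi : fps R).

Lemma fps_comp_coef0 f g : (f \oF g) 0%N = f 0%N.
Proof. by rewrite /= big_ord1 expr0 /= mulr1. Qed.

Lemma fps_comp0 f g : f 0%N = 0 -> (f \oF g) 0%N = 0.
Proof. by move=> f0; rewrite fps_comp_coef0. Qed.

Lemma fps_comp_coef1 f g : (f \oF g) 1%N = f 1%N * g 1%N.
Proof. by rewrite /= !big_ord_recl big_ord0 /= expr1 mulr0 add0r addr0. Qed.

(** Both sides have [n]-th coefficient equal to the sum of [f i * g j * (h ^+ (i + j)) n] over the
    square [i, j <= n]. *)
Lemma fps_compMl f g h : h 0%N = 0 -> (f * g) \oF h = (f \oF h) * (g \oF h).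
Proof.
move=> h0; apply: fpsP => n.
transitivity (\sum_(i < n.+1) \sum_(j < n.+1) f i * g j * (h ^+ (i + j)) n).
  rewrite /= (eq_bigr (fun k : 'I_n.+1 =>
    \sum_(i < n.+1 | (i <= k)%N) f i * g (k - i)%N * (h ^+ k) n)); last first.
    move=> k _; rewrite mulr_suml.
    by rewrite (big_ord_widen n.+1 (fun i => f i * g (k - i)%N * (h ^+ k) n)).
  rewrite (exchange_big_dep xpredT) //=; apply: eq_bigr => i _.
  pose F k := f i * g (k - i)%N * (h ^+ k) n.
  rewrite -(big_mkord (fun k => i <= k)%N F).
  rewrite -(big_mkord xpredT (fun j => f i * g j * (h ^+ (i + j)) n)).
  have lin : (i <= n.+1)%N := ltnW (ltn_ord i).
  rewrite (@big_cat_nat _ _ _ i) //= big_nat_cond big1 ?add0r; last first.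
    by move=> k /andP[/andP[_ lki] lik]; move: lki; rewrite ltnNge lik.
  (* The corner [i + j > n] of the square contributes nothing, because [h ^+ (i + j)] has order
     greater than [n]. *)
  rewrite [RHS](@big_cat_nat _ _ _ (n.+1 - i)%N) ?leq_subr //=.
  rewrite [X in _ = _ + X]big_nat_cond [X in _ = _ + X]big1 ?addr0; last first.
    move=> j /andP[/andP[lj _] _]; rewrite fps_coefX_lt ?mulr0 //.
    by move: lj; rewrite leq_subLR.
  rewrite -{1}[i : nat]add0n big_addn big_nat_cond [RHS]big_nat_cond.
  apply: eq_big => [j|j _]; first by rewrite leq_addl.
  by rewrite /F addnK [(i + j)%N]addnC.
symmetry; rewrite coef_fpsM.
transitivity (\sum_(m < n.+1) \sum_(i < n.+1) \sum_(j < n.+1)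
    f i * g j * ((h ^+ i) m * (h ^+ j) (n - m)%N)).
  apply: eq_bigr => m _.
  rewrite !(@fps_compE _ n.+1) ?ltnS ?leq_subr ?leq_ord //.
  rewrite mulr_suml; apply: eq_bigr => i _; rewrite mulr_sumr.
  by apply: eq_bigr => j _; rewrite mulrACA.
rewrite exchange_big; apply: eq_bigr => i _; rewrite exchange_big.
by apply: eq_bigr => j _; rewrite -mulr_sumr exprD coef_fpsM.
Qed.

Lemma fps_NXcomp g : g 0%N = 0 -> - fpsX \oF g = - g.
Proof. by move=> g0; rewrite fps_compNl fps_Xcomp. Qed.

Lemma fps_NX0 : (- fpsX : fps R) 0%N = 0.
Proof. by rewrite coef_fpsN oppr0. Qed.

Lemma fps_NXNX : - fpsX \oF - fpsX = fpsX :> fps R.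
Proof. by rewrite fps_NXcomp ?fps_NX0 // opprK. Qed.

(** * Identities relative to a compositional involution [N] *)

Section Involution.
Variable N : fps R.
Hypotheses (N0 : N 0%N = 0) (NN : N \oF N = fpsX).

Let NC0 g : (N \oF g) 0%N = 0.
Proof. exact: fps_comp0. Qed.

Lemma fps_involutionK g : g 0%N = 0 -> N \oF (N \oF g) = g.
Proof. by move=> g0; rewrite (fps_compA _ N0 g0) NN fps_Xcomp. Qed.

(** For [N = -z] the last two hypotheses say that [t] is the pseudo-inverse of [h]. One direction
    composes with [N \oF h] on the right, the other with [N \oF t]. *)
Lemma fps_twisted_invP f h t : h 0%N = 0 -> t 0%N = 0 ->
    h \oF (N \oF t) = N -> t \oF (N \oF h) = N ->
  f = h \oF t <-> f \oF (N \oF h) = h \oF N.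
Proof.
move=> h0 t0 hNt tNh; split=> [->|fNh].
  by rewrite -(fps_compA _ t0 (NC0 h)) tNh.
rewrite -[LHS]fps_compX -NN -{2}hNt.
rewrite (fps_compA _ h0 (NC0 t)) (fps_compA _ (NC0 h) (NC0 t)) fNh.
by rewrite -(fps_compA _ N0 (NC0 t)) (fps_involutionK t0).
Qed.

Lemma fps_twisted_inv_factor f s t : f 0%N = 0 -> s 0%N = 0 ->
  t \oF (N \oF s) = N -> s \oF (N \oF f) = N \oF s -> f = t \oF s.
Proof.
move=> f0 s0 tNs sNf; rewrite -(fps_involutionK s0) -sNf.
rewrite (fps_compA _ s0 (NC0 f)) (fps_compA _ (NC0 s) (NC0 f)) tNs.
by rewrite (fps_involutionK f0).
Qed.

Lemma fps_twisted_inv_conj s t phi : s 0%N = 0 -> t 0%N = 0 -> phi 0%N = 0 ->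
    s \oF (N \oF t) = N -> phi \oF N = N \oF phi ->
  (t \oF s) \oF (N \oF (t \oF phi)) = (t \oF phi) \oF N.
Proof.
move=> s0 t0 phi0 sNt phiN; rewrite -(fps_compA _ phi0 N0) phiN.
rewrite -(fps_compA _ s0 (NC0 _)) (fps_compA _ t0 phi0).
by rewrite (fps_compA _ (NC0 t) phi0) sNt.
Qed.

(** The choice of [phi] is forced: N o s o N is the compositional inverse of [t], so [phi] is the
    only candidate for [h = t \oF phi]. *)
Lemma fps_twisted_inv_quotient s t h (phi := N \oF (s \oF (N \oF h))) :
    s 0%N = 0 -> t 0%N = 0 -> h 0%N = 0 ->
    s \oF (N \oF t) = N -> t \oF (N \oF s) = N ->
    (t \oF s) \oF (N \oF h) = h \oF N ->
  phi \oF N = N \oF phi /\ h = t \oF phi.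
Proof.
move=> s0 t0 h0 sNt tNs tsNh; have Nh0 := NC0 h.
have sNh0 := fps_comp0 (N \oF h) s0.
rewrite -(fps_compA t s0 Nh0) in tsNh.
split; rewrite /phi; last first.
  rewrite (fps_compA _ s0 Nh0) (fps_compA _ (NC0 s) Nh0) tNs.
  by rewrite (fps_involutionK h0).
rewrite (fps_involutionK sNh0).
rewrite -(fps_compA _ sNh0 N0) -(fps_compA _ Nh0 N0) -(fps_compA _ h0 N0).
(* With u = s o N o h, what remains is N o s o N o t o u = u, which follows from s o N o t = N. *)
rewrite -tsNh; move: (s \oF (N \oF h)) sNh0 => u u0.
rewrite (fps_compA _ t0 u0) (fps_compA _ (NC0 t) u0) sNt.
by rewrite (fps_involutionK u0).
Qed.

End Involution.
End Composition.

(** * Coefficient arguments and the pseudo-inverse over a field *)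

Section PseudoInverse.
Variable K : fieldType.
Implicit Types (a b f g h : fps K).

Lemma fps_order1_coef0 a : fps_order 1 a -> a 0%N = 0.
Proof. by move=> /fps_orderE[]. Qed.

(** Once [b] vanishes below degree [n], coefficient [n.+1] of the product is [a 1 * b n]. *)
Lemma fps_mul_order1_eq0 a b : fps_order 1 a -> a * b = 0 -> b = 0.
Proof.
move=> /fps_orderE[a0 /eqP a1] ab; apply: fpsP => n.
elim/ltn_ind: n => n IH; apply/eqP.
have /eqP : (a * b) n.+1 = 0 by rewrite ab.
rewrite coef_fpsM !big_ord_recl /= a0 mul0r add0r subSS subn0 big1 ?addr0.
  by rewrite mulf_eq0 (negPf a1).
by move=> i _; rewrite IH ?mulr0 // !subSS ltn_subrL /=; case: n i {IH} => [[]|].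
Qed.

(** Since [g ^+ n] starts with z^n, the lowest coefficient c of [a] would survive in [a \oF g],
    giving c = -c. *)
Lemma fps_anti_invariant_eq0 a g : 2%:R != 0 :> K ->
  g 0%N = 0 -> g 1%N = 1 -> a \oF g = - a -> a = 0.
Proof.
move=> two0 g0 g1 ag; apply: fpsP => n.
have gnn k : (g ^+ k) k = 1.
  elim: k => // k IH; rewrite exprS coef_fpsM 2!big_ord_recl /= g0 mul0r add0r.
  rewrite g1 mul1r subSS subn0 IH big1 ?addr0 // => i _.
  rewrite fps_coefX_lt ?mulr0 // !subSS ltn_subrL /=.
  by case: k i {IH} => [[]|].
elim/ltn_ind: n => n IH; have /eqP := congr1 (fun u : fps K => u n) ag.
rewrite /= big_ord_recr /= big1 => [|i _]; last by rewrite IH ?mul0r ?ltn_ord.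
rewrite gnn add0r mulr1 -addr_eq0 -mulr2n -mulr_natl mulf_eq0 (negPf two0).
by move=> /eqP.
Qed.

Lemma fps_involution_id g : 2%:R != 0 :> K ->
  g 0%N = 0 -> g 1%N = 1 -> g \oF g = fpsX -> g = fpsX.
Proof.
move=> two0 g0 g1 gg; apply/eqP; rewrite -subr_eq0; apply/eqP.
(* Substituting [g] turns g - z into z - g. *)
apply: (fps_anti_invariant_eq0 two0 g0 g1).
by rewrite fps_compDl fps_compNl gg fps_Xcomp // opprB.
Qed.

Lemma fps_pseudo_inv0 a : fps_pseudo_inv a 0%N = 0.
Proof. exact: fps_comp0 (fps_NX0 K). Qed.

Lemma fps_pseudo_invr a : fps_order 1 a ->
  a \oF (- fpsX \oF fps_pseudo_inv a) = - fpsX.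
Proof.
move=> a1; have [/fps_order1_coef0 i0 ai _] := fps_compinvP a1.
rewrite /fps_pseudo_inv.
rewrite (fps_involutionK (fps_NX0 K) (fps_NXNX K) (fps_comp0 _ i0)).
by rewrite (fps_compA _ i0 (fps_NX0 K)) ai (fps_Xcomp (fps_NX0 K)).
Qed.

Lemma fps_pseudo_invl a : fps_order 1 a ->
  fps_pseudo_inv a \oF (- fpsX \oF a) = - fpsX.
Proof.
move=> a1; have [/fps_order1_coef0 i0 _ ia] := fps_compinvP a1.
rewrite /fps_pseudo_inv; move: (- fpsX : fps K) (fps_NX0 K) (fps_NXNX K) => N N0 NN.
have a0 := fps_order1_coef0 a1; have Na0 := fps_comp0 a N0.
rewrite -(fps_compA _ (fps_comp0 N i0) Na0) -(fps_compA _ N0 Na0).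
by rewrite (fps_involutionK N0 NN a0) ia fps_compX.
Qed.

(** * Pseudo-involutory series and their factorizations *)

Section PseudoInvolution.
Hypothesis two0 : 2%:R != 0 :> K.
Variable f : fps K.
Hypotheses (f_pi : fps_pseudo_involutory f) (f_neq : f <> - fpsX).

Lemma fps_pseudo_involutoryE : f \oF (- fpsX \oF f) = - fpsX.
Proof. by have [f1 {1}<-] := f_pi; apply: fps_pseudo_invl. Qed.

(** The linear term of f o (-f) = -z gives f'(0)^2 = 1. If f'(0) = -1, then -f is an involution
    tangent to the identity, hence equal to z, which [f_neq] excludes. *)
Lemma fps_pseudo_involutory_coef1 : f 1%N = 1.
Proof.
have [/fps_order1_coef0 f0 _] := f_pi; have fNf := fps_pseudo_involutoryE.
have Nf : - fpsX \oF f = - f by rewrite fps_NXcomp.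
have /eqP := congr1 (fun u : fps K => u 1%N) fNf.
rewrite Nf fps_comp_coef1 !coef_fpsN /= mulrN eqr_opp -expr2 sqrf_eq1.
case/orP => /eqP // f1; case: f_neq; apply: oppr_inj; rewrite opprK.
apply: fps_involution_id => //; first by rewrite coef_fpsN f0 oppr0.
  by rewrite coef_fpsN f1 opprK.
by rewrite fps_compNl -Nf fNf opprK.
Qed.

Let s := fps_sqrt (fpsX * f).

Lemma fps_sqrt_order1 : fps_order 1 s.
Proof.
have [/fps_order1_coef0 f0 _] := f_pi.
have [_ s0 s1] := fps_sqrtP two0 f0 fps_pseudo_involutory_coef1.
by apply/fps_orderE; rewrite -/s s1; split=> //; apply/eqP/oner_neq0.
Qed.

Lemma fps_sqrt_conj : s \oF (- fpsX \oF f) = - fpsX \oF s.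
Proof.
have [/fps_order1_coef0 f0 _] := f_pi; have f1 := fps_pseudo_involutory_coef1.
have [s2 s0 s1] := fps_sqrtP two0 f0 f1; rewrite -/s in s2 s0 s1.
have g0 := fps_comp0 f (fps_NX0 K); have fg := fps_pseudo_involutoryE.
have gE : - fpsX \oF f = - f by rewrite (fps_NXcomp f0).
rewrite (fps_NXcomp s0); move: (- fpsX \oF f) g0 fg gE => g g0 fg gE.
apply/eqP; rewrite -addr_eq0; apply/eqP.
(* Here g = -f, and (s o g)^2 - s^2 = 0 factors as a difference of squares. The factor [s \oF g - s]
   has linear coefficient -2, so it cancels. *)
apply: (@fps_mul_order1_eq0 (s \oF g - s)); last first.
  rewrite -subr_sqr expr2 -(fps_compMl _ _ g0) -expr2 s2 (fps_compMl _ _ g0).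
  by rewrite fg (fps_Xcomp g0) gE mulrNN mulrC subrr.
apply/fps_orderE; rewrite !coef_fpsD !coef_fpsN fps_comp_coef0 fps_comp_coef1.
rewrite s0 s1 gE coef_fpsN f1 mul1r -opprD subrr; split=> //.
by apply/eqP; rewrite oppr_eq0.
Qed.

Lemma fps_pseudo_involutory_sqrt : f = fps_pseudo_inv s \oF s.
Proof.
have s1 := fps_sqrt_order1; have [/fps_order1_coef0 f0 _] := f_pi.
apply: (fps_twisted_inv_factor (fps_NX0 K) (fps_NXNX K) f0).
- exact: fps_order1_coef0.
- exact: fps_pseudo_invl.
- exact: fps_sqrt_conj.
Qed.

Lemma fps_pseudo_involutory_factor h : fps_order 1 h ->
  f = h \oF fps_pseudo_inv h <->
  exists phi, fps_odd phi /\ h = fps_pseudo_inv s \oF phi.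
Proof.
move=> h1; have h0 := fps_order1_coef0 h1.
have s1 := fps_sqrt_order1; have s0 := fps_order1_coef0 s1.
have N0 := fps_NX0 K; have NN := fps_NXNX K; have t0 := fps_pseudo_inv0 s.
have sNt := fps_pseudo_invr s1; have tNs := fps_pseudo_invl s1.
have fE := fps_pseudo_involutory_sqrt.
have [fE1 fE2] := fps_twisted_invP N0 NN f h0 (fps_pseudo_inv0 h)
  (fps_pseudo_invr h1) (fps_pseudo_invl h1).
split=> [/fE1|[phi [phi_odd hE]]].
  rewrite {1}fE => fNh.
  have [phiN hE] := fps_twisted_inv_quotient N0 NN s0 t0 h0 sNt tNs fNh.
  eexists; split; last exact: hE.
  by rewrite /fps_odd phiN; apply: fps_NXcomp (fps_comp0 _ N0).
(* Oddness in degree 0 reads [phi 0 = - phi 0]; the vanishing constant term makes composition with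
   [phi] on the right associative. *)
have phi0 : phi 0%N = 0.
  have /eqP := congr1 (fun u : fps K => u 0%N) phi_odd.
  rewrite fps_comp_coef0 coef_fpsN -addr_eq0 -mulr2n -mulr_natl mulf_eq0.
  by rewrite (negPf two0) => /eqP.
apply: fE2; rewrite {1}fE hE; apply: (fps_twisted_inv_conj N0 s0 t0 phi0 sNt).
by rewrite phi_odd (fps_NXcomp phi0).
Qed.

End PseudoInvolution.
End PseudoInverse.

Theorem theorem2p2 (R : realType) (f : fps R)
    (f_pi : fps_pseudo_involutory f) (f_neq : f <> - fpsX) :
  f = fps_pseudo_inv (fps_sqrt (fpsX * f)) \oF fps_sqrt (fpsX * f) /\
  (forall h : fps R, fps_order 1 h ->
     (f = h \oF fps_pseudo_inv h <->
      exists phi : fps R,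
        fps_odd phi /\ h = fps_pseudo_inv (fps_sqrt (fpsX * f)) \oF phi)).
Proof.
have two0 : 2%:R != 0 :> R by rewrite pnatr_eq0.
split; first exact: fps_pseudo_involutory_sqrt.
by move=> h h1; apply: fps_pseudo_involutory_factor.
Qed.
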